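(* Consider the $D_4^{(1)}$ system (defined in the context) restricted to parameters with $\alpha_4=\alpha_1$, and set $\beta_0:=\alpha_0$, $\beta_1:=\alpha_3$, $\beta_2:=\alpha_2$, $\beta_3:=\alpha_1$, so that $\beta_0+\beta_1+2\beta_2+2\beta_3=1$. This system admits the affine Weyl group symmetry of type $B_3^{(1)}$ as the group of its Bäcklund transformations, whose generators are explicitly given as follows, with the notation $( * ):=(x,y,z;\beta_0,\beta_1,\beta_2,\beta_3)$: $$\begin{aligned} s_0:( * )&\rightarrow\left(x,y,z-\tfrac{\beta_0}{x-\eta};-\beta_0,\beta_1,\beta_2+\beta_0,\beta_3\right),\\ s_1:( * )&\rightarrow\left(x,y,z-\tfrac{\beta_1}{y-1};\beta_0,-\beta_1,\beta_2+\beta_1,\beta_3\right),\\ s_2:( * )&\rightarrow\left(x+\tfrac{\beta_2}{z},y+\tfrac{\beta_2}{z},z;\beta_0+\beta_2,\beta_1+\beta_2,-\beta_2,\beta_3+\beta_2\right),\\ s_3:( * )&\rightarrow\left(x,y,z-\tfrac{\beta_3(x+y)}{xy};\beta_0,\beta_1,\beta_2+2\beta_3,-\beta_3\right). \end{aligned}$$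
   Context: A Bäcklund transformation of a parametrized system is a birational transformation of the variables and parameters that takes the system with the original parameters to the system of the same form with the transformed parameters (here $\eta$ and $b(t)$ are unchanged). Affine Weyl group symmetry of type $B_3^{(1)}$ means that each $s_i$ is a Bäcklund transformation and that the $s_i$ satisfy the fundamental relations of the affine Weyl group of type $B_3^{(1)}$: $s_i^2=1$, $(s_0s_2)^3=(s_1s_2)^3=1$, $(s_2s_3)^4=1$, $(s_0s_1)^2=(s_0s_3)^2=(s_1s_3)^2=1$. The $D_4^{(1)}$ system. Let $\eta\in\mathbb{C}\setminus\{0\}$, let $b(t)\in\mathbb{C}(t)$ be nonzero, and let $\alpha_0,\dots,\alpha_4\in\mathbb{C}$ satisfy $\alpha_0+\alpha_1+2\alpha_2+\alpha_3+\alpha_4=1$. The $D_4^{(1)}$ system for unknown functions $x,y,z$ of $t$ is $$\frac{2\eta}{b(t)}\frac{dx}{dt}=P,\qquad -\frac{2\eta}{b(t)}\frac{dy}{dt}=Q,\qquad \frac{2\eta}{b(t)}\frac{dz}{dt}=R,$$ where $P=-2x(y-1)yz(x-\eta)(2x-2y+1-\eta)-2(2\alpha_0+2\alpha_1+4\alpha_2+\alpha_3+\alpha_4)x^3y-2(\alpha_0+\alpha_1)xy^3+(5\alpha_0+5\alpha_1+6\alpha_2+\alpha_3+\alpha_4)x^2y^2-\{5\alpha_0+5\alpha_1+6\alpha_2+2\alpha_3-3(2\alpha_0+2\alpha_1+4\alpha_2+\alpha_3+\alpha_4)\eta\}x^2y+\{3(\alpha_0+\alpha_1)-(4\alpha_0+6\alpha_1+6\alpha_2+\alpha_3+\alpha_4)\eta\}xy^2+x^4+2(\alpha_0+\alpha_1+2\alpha_2+\alpha_3-\eta)x^3+2\alpha_1\eta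 y^3+\{(\alpha_0+\alpha_1+2\alpha_2+\alpha_3)(\eta^2-3\eta+1)+\alpha_4\eta^2\}x^2+\alpha_1(\eta-3)\eta y^2+\{-(\alpha_0+\alpha_1)+2(2\alpha_0+3\alpha_1+3\alpha_2+\alpha_3)\eta-(2\alpha_0+2\alpha_1+4\alpha_2+\alpha_3+\alpha_4)\eta^2\}xy+(\alpha_0+\alpha_1+2\alpha_2+\alpha_3)(\eta-1)\eta x-\alpha_1(\eta-1)\eta y$, $Q=2x(y-1)yz(x-\eta)(2x-2y+1-\eta)-2(\alpha_3+\alpha_4)x^3y-2(\alpha_0+\alpha_1+4\alpha_2+2\alpha_3+2\alpha_4)xy^3+(\alpha_0+\alpha_1+6\alpha_2+5\alpha_3+5\alpha_4)x^2y^2+\{-(\alpha_0+\alpha_1+6\alpha_2+4\alpha_3+6\alpha_4)+3(\alpha_3+\alpha_4)\eta\}x^2y+\{3(\alpha_0+\alpha_1+4\alpha_2+2\alpha_3+2\alpha_4)-(2\alpha_0+6\alpha_2+5\alpha_3+5\alpha_4)\eta\}xy^2+y^4+2\alpha_4x^3+2\{(\alpha_0+2\alpha_2+\alpha_3+\alpha_4)\eta-1\}y^3-\alpha_4(3\eta-1)x^2+\{1-3(\alpha_0+2\alpha_2+\alpha_3+\alpha_4)\eta+(\alpha_0+2\alpha_2+\alpha_3+\alpha_4)\eta^2\}y^2+\{-(\alpha_0+\alpha_1+4\alpha_2+2\alpha_3+2\alpha_4)+2(\alpha_0+3\alpha_2+2\alpha_3+3\alpha_4)\eta-(\alpha_3+\alpha_4)\eta^2\}xy+\alpha_4(\eta-1)\eta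 x-(\alpha_0+2\alpha_2+\alpha_3+\alpha_4)(\eta-1)\eta y$, $R=(2x-2y+1-\eta)\{2x^2y+2xy^2-x^2-\eta y^2-2(\eta+1)xy+\eta(x+y)\}z^2+z\big[-2(\alpha_3+\alpha_4)x^3+2(\alpha_0+\alpha_1)y^3+2(\alpha_0+\alpha_1+6\alpha_2+2\alpha_3+2\alpha_4)x^2y-2(2\alpha_0+2\alpha_1+6\alpha_2+\alpha_3+\alpha_4)xy^2+\{-(\alpha_0+\alpha_1+6\alpha_2+4\alpha_3)+3(\alpha_3+\alpha_4)\eta\}x^2+\{-3(\alpha_0+\alpha_1)+(4\alpha_0+6\alpha_2+\alpha_3+\alpha_4)\eta\}y^2-4\{-(\alpha_0+\alpha_1+3\alpha_2+\alpha_3)+(\alpha_0+3\alpha_2+\alpha_3+\alpha_4)\eta\}xy+\{-(\alpha_0+\alpha_1+4\alpha_2+2\alpha_3)+2(\alpha_0+3\alpha_2+2\alpha_3)\eta-(\alpha_3+\alpha_4)\eta^2\}x+\{\alpha_0+\alpha_1-2(2\alpha_0+3\alpha_2+\alpha_3)\eta+(2\alpha_0+4\alpha_2+\alpha_3+\alpha_4)\eta^2\}y-(\alpha_0+2\alpha_2+\alpha_3)(\eta-1)\eta\big]+\alpha_2\big[(\alpha_0+\alpha_1+2\alpha_2-\alpha_3-\alpha_4)x^2+(\alpha_0+\alpha_1-2\alpha_2-\alpha_3-\alpha_4)y^2-2(\alpha_0+\alpha_1-\alpha_3-\alpha_4)xy+\{\alpha_0+\alpha_1-2\alpha_3-(2\alpha_0+2\alpha_2-\alpha_3-\alpha_4)\eta\}x+\{-\alpha_0-\alpha_1+2\alpha_2+2\alpha_3+(2\alpha_0-\alpha_3-\alpha_4)\eta\}y+(\eta-1)(\alpha_2+\alpha_3+(\alpha_0+\alpha_2)\eta)\big]$.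 *)

(* Defs.v *)
From HB Require Import structures.
From mathcomp Require Import all_boot all_order all_algebra.
From mathcomp Require Import reals complex mpoly.
Set Implicit Arguments.
Unset Strict Implicit.
Unset Printing Implicit Defensive.
Import GRing.Theory.
Local Open Scope ring_scope.

(* The field of complex numbers is R[i], for R : realType. *)

Notation Ct R := {fraction {poly R[i]}}.

Definition constCt (R : realType) (c : R[i]) : Ct R := tofrac c%:P.

(* A differential field extension of (C(t), d/dt), for instance the field of
   meromorphic functions on a connected open subset of the complex plane: the
   "functions of t" in which solutions are sought.  Additivity and the Leibniz
   rule, together with the values on constants and on t, force the derivation
   to restrict to d/dt on C(t). *)
Record diff_ext (R : realType) := DiffExt {
  de_field :> fieldType;
  de_emb : {rmorphism Ct R -> de_field};
  de_der : de_field -> de_field;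
  de_derD : forall u v, de_der (u + v) = de_der u + de_der v;
  de_derM : forall u v, de_der (u * v) = de_der u * v + u * de_der v;
  de_der_const : forall c : R[i], de_der (de_emb (constCt c)) = 0;
  de_der_t : de_der (de_emb (tofrac 'X)) = 1 }.

Definition de_const (R : realType) (L : diff_ext R) (c : R[i]) : L :=
  de_emb L (constCt c).

Definition D4_P (K : fieldType) (eta a0 a1 a2 a3 a4 x y z : K) : K :=
  - 2 * x * (y - 1) * y * z * (x - eta) * (2 * x - 2 * y + 1 - eta)
  - 2 * (2 * a0 + 2 * a1 + 4 * a2 + a3 + a4) * x ^+ 3 * y
  - 2 * (a0 + a1) * x * y ^+ 3
  + (5 * a0 + 5 * a1 + 6 * a2 + a3 + a4) * x ^+ 2 * y ^+ 2
  - (5 * a0 + 5 * a1 + 6 * a2 + 2 * a3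
     - 3 * (2 * a0 + 2 * a1 + 4 * a2 + a3 + a4) * eta) * x ^+ 2 * y
  + (3 * (a0 + a1) - (4 * a0 + 6 * a1 + 6 * a2 + a3 + a4) * eta) * x * y ^+ 2
  + x ^+ 4
  + 2 * (a0 + a1 + 2 * a2 + a3 - eta) * x ^+ 3
  + 2 * a1 * eta * y ^+ 3
  + ((a0 + a1 + 2 * a2 + a3) * (eta ^+ 2 - 3 * eta + 1) + a4 * eta ^+ 2)
    * x ^+ 2
  + a1 * (eta - 3) * eta * y ^+ 2
  + (- (a0 + a1) + 2 * (2 * a0 + 3 * a1 + 3 * a2 + a3) * eta
     - (2 * a0 + 2 * a1 + 4 * a2 + a3 + a4) * eta ^+ 2) * x * y
  + (a0 + a1 + 2 * a2 + a3) * (eta - 1) * eta * x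
  - a1 * (eta - 1) * eta * y.

Definition D4_Q (K : fieldType) (eta a0 a1 a2 a3 a4 x y z : K) : K :=
  2 * x * (y - 1) * y * z * (x - eta) * (2 * x - 2 * y + 1 - eta)
  - 2 * (a3 + a4) * x ^+ 3 * y
  - 2 * (a0 + a1 + 4 * a2 + 2 * a3 + 2 * a4) * x * y ^+ 3
  + (a0 + a1 + 6 * a2 + 5 * a3 + 5 * a4) * x ^+ 2 * y ^+ 2
  + (- (a0 + a1 + 6 * a2 + 4 * a3 + 6 * a4) + 3 * (a3 + a4) * eta)
    * x ^+ 2 * y
  + (3 * (a0 + a1 + 4 * a2 + 2 * a3 + 2 * a4)
     - (2 * a0 + 6 * a2 + 5 * a3 + 5 * a4) * eta) * x * y ^+ 2
  + y ^+ 4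
  + 2 * a4 * x ^+ 3
  + 2 * ((a0 + 2 * a2 + a3 + a4) * eta - 1) * y ^+ 3
  - a4 * (3 * eta - 1) * x ^+ 2
  + (1 - 3 * (a0 + 2 * a2 + a3 + a4) * eta
     + (a0 + 2 * a2 + a3 + a4) * eta ^+ 2) * y ^+ 2
  + (- (a0 + a1 + 4 * a2 + 2 * a3 + 2 * a4)
     + 2 * (a0 + 3 * a2 + 2 * a3 + 3 * a4) * eta
     - (a3 + a4) * eta ^+ 2) * x * y
  + a4 * (eta - 1) * eta * x
  - (a0 + 2 * a2 + a3 + a4) * (eta - 1) * eta * y.

Definition D4_R (K : fieldType) (eta a0 a1 a2 a3 a4 x y z : K) : K :=
  (2 * x - 2 * y + 1 - eta)
  * (2 * x ^+ 2 * y + 2 * x * y ^+ 2 - x ^+ 2 - eta * y ^+ 2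
     - 2 * (eta + 1) * x * y + eta * (x + y)) * z ^+ 2
  + z * (- 2 * (a3 + a4) * x ^+ 3
         + 2 * (a0 + a1) * y ^+ 3
         + 2 * (a0 + a1 + 6 * a2 + 2 * a3 + 2 * a4) * x ^+ 2 * y
         - 2 * (2 * a0 + 2 * a1 + 6 * a2 + a3 + a4) * x * y ^+ 2
         + (- (a0 + a1 + 6 * a2 + 4 * a3) + 3 * (a3 + a4) * eta) * x ^+ 2
         + (- 3 * (a0 + a1) + (4 * a0 + 6 * a2 + a3 + a4) * eta) * y ^+ 2
         - 4 * (- (a0 + a1 + 3 * a2 + a3) + (a0 + 3 * a2 + a3 + a4) * eta)
           * x * y
         + (- (a0 + a1 + 4 * a2 + 2 * a3)
            + 2 * (a0 + 3 * a2 + 2 * a3) * eta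
            - (a3 + a4) * eta ^+ 2) * x
         + (a0 + a1 - 2 * (2 * a0 + 3 * a2 + a3) * eta
            + (2 * a0 + 4 * a2 + a3 + a4) * eta ^+ 2) * y
         - (a0 + 2 * a2 + a3) * (eta - 1) * eta)
  + a2 * ((a0 + a1 + 2 * a2 - a3 - a4) * x ^+ 2
          + (a0 + a1 - 2 * a2 - a3 - a4) * y ^+ 2
          - 2 * (a0 + a1 - a3 - a4) * x * y
          + (a0 + a1 - 2 * a3 - (2 * a0 + 2 * a2 - a3 - a4) * eta) * x
          + (- a0 - a1 + 2 * a2 + 2 * a3 + (2 * a0 - a3 - a4) * eta) * y
          + (eta - 1) * (a2 + a3 + (a0 + a2) * eta)).

Definition D4_system (R : realType) (eta : R[i]) (b : Ct R) (L : diff_ext R)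
    (a0 a1 a2 a3 a4 : R[i]) (x y z : L) : Prop :=
  let c := de_const L in
  let k := 2 * c eta / de_emb L b in
  let rhs (F : L -> L -> L -> L -> L -> L -> L -> L -> L -> L) :=
    F (c eta) (c a0) (c a1) (c a2) (c a3) (c a4) x y z in
  [/\ a0 + a1 + 2 * a2 + a3 + a4 = 1,
      k * de_der x = rhs (@D4_P L),
      - k * de_der y = rhs (@D4_Q L)
    & k * de_der z = rhs (@D4_R L)].

(* The restriction a4 = a1 of the system, with
   (be0, be1, be2, be3) = (a0, a3, a2, a1). *)
Definition B3_system (R : realType) (eta : R[i]) (b : Ct R) (L : diff_ext R)
    (be0 be1 be2 be3 : R[i]) (x y z : L) : Prop :=
  D4_system eta b be0 be3 be2 be1 be3 x y z.

(* The function field over C(t) of the space of variables and parameters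
   (x, y, z; be0, be1, be2, be3) with be0 + be1 + 2 be2 + 2 be3 = 1: the
   independent coordinates are x, y, z, be1, be2, be3, and be0 is eliminated. *)
Notation ratfun R := {fraction {mpoly (Ct R)[6]}}.

Definition ratconst (R : realType) (c : Ct R) : ratfun R :=
  tofrac (mpolyC 6 c).

Definition coord (R : realType) (i : 'I_6) : ratfun R :=
  tofrac ('X_i : {mpoly (Ct R)[6]}).

Definition var_x (R : realType) := coord R (@Ordinal 6 0 isT).
Definition var_y (R : realType) := coord R (@Ordinal 6 1 isT).
Definition var_z (R : realType) := coord R (@Ordinal 6 2 isT).
Definition par_be1 (R : realType) := coord R (@Ordinal 6 3 isT).
Definition par_be2 (R : realType) := coord R (@Ordinal 6 4 isT).
Definition par_be3 (R : realType) := coord R (@Ordinal 6 5 isT).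
Definition par_be0 (R : realType) : ratfun R :=
  1 - par_be1 R - 2 * par_be2 R - 2 * par_be3 R.

(* The coordinates in L of a point (x, y, z; be0, be1, be2, be3), in the order
   of the indeterminates of ratfun R. *)
Definition point (R : realType) (L : diff_ext R) (x y z : L)
    (be1 be2 be3 : R[i]) : 'I_6 -> L :=
  fun i => nth 0 [:: x; y; z; de_const L be1; de_const L be2; de_const L be3] i.

(* The rational function f is defined at the point v, with value w: some
   representation p / q of f has a denominator that does not vanish at v. *)
Definition has_value (R : realType) (L : diff_ext R) (f : ratfun R)
    (v : 'I_6 -> L) (w : L) : Prop :=
  exists p q : {mpoly (Ct R)[6]},
    [/\ f = tofrac p / tofrac q,
        mmap (de_emb L) v q != 0
      & w = mmap (de_emb L) v p / mmap (de_emb L) v q].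

(* A birational transformation is given by its comorphism, an automorphism of
   the function field over C(t): it sends each coordinate to the rational
   function which expresses the corresponding transformed coordinate. *)
Definition birational (R : realType) (s : ratfun R -> ratfun R) : Prop :=
  (forall c : Ct R, s (ratconst c) = ratconst c) /\ bijective s.

(* s takes the system to the system of the same form: wherever s is defined on
   a solution, it yields complex parameters and a solution of the system with
   these parameters. *)
Definition takes_B3_system (R : realType) (eta : R[i]) (b : Ct R)
    (s : ratfun R -> ratfun R) : Prop :=
  forall (L : diff_ext R) (be0 be1 be2 be3 : R[i]) (x y z : L),
    B3_system eta b be0 be1 be2 be3 x y z ->
  forall x' y' z' w0 w1 w2 w3 : L,
    let v := point x y z be1 be2 be3 in
    has_value (s (var_x R)) v x' ->
    has_value (s (var_y R)) v y' ->
    has_value (s (var_z R)) v z' ->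
    has_value (s (par_be0 R)) v w0 ->
    has_value (s (par_be1 R)) v w1 ->
    has_value (s (par_be2 R)) v w2 ->
    has_value (s (par_be3 R)) v w3 ->
  exists be0' be1' be2' be3' : R[i],
    [/\ w0 = de_const L be0', w1 = de_const L be1',
        w2 = de_const L be2', w3 = de_const L be3'
      & B3_system eta b be0' be1' be2' be3' x' y' z'].

Definition backlund_B3 (R : realType) (eta : R[i]) (b : Ct R)
    (s : ratfun R -> ratfun R) : Prop :=
  birational s /\ takes_B3_system eta b s.

Definition images (R : realType) (s : ratfun R -> ratfun R) :=
  (s (var_x R), s (var_y R), s (var_z R),
   (s (par_be0 R), s (par_be1 R), s (par_be2 R), s (par_be3 R))).

(* Composition of comorphisms reverses that of the transformations, but
   (s s')^n = 1 and (s' s)^n = 1 are equivalent. *)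
Definition weyl_B3_1 (T : Type) (s0 s1 s2 s3 : T -> T) : Prop :=
  [/\ [/\ s0 \o s0 =1 id, s1 \o s1 =1 id, s2 \o s2 =1 id & s3 \o s3 =1 id],
      iter 3 (s0 \o s2) =1 id /\ iter 3 (s1 \o s2) =1 id,
      iter 4 (s2 \o s3) =1 id
    & [/\ iter 2 (s0 \o s1) =1 id, iter 2 (s0 \o s3) =1 id
        & iter 2 (s1 \o s3) =1 id]].

(* Main.v *)
Require Import Defs.
From HB Require Import structures.
From mathcomp Require Import all_boot all_order all_algebra.
From mathcomp Require Import reals complex mpoly.
From mathcomp Require Import ring.
Set Implicit Arguments.
Unset Strict Implicit.
Unset Printing Implicit Defensive.
Import GRing.Theory.
Local Open Scope ring_scope.

(** Three independent facts make up the theorem.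

    Existence and birationality.  Each generator is given by six rational
    functions, and substituting them into themselves gives back the
    coordinates.  This already makes the substitution injective on polynomials,
    so that it extends to the function field, where it is an involution
    ([involution_of_images]).  The computation is carried out with a relation
    [value_at ev u w], saying that the fraction [u] is regular at the ring
    morphism [ev] with value [w]; it is compatible with the field operations
    and single-valued.

    Bäcklund property.  When the derivation is applied to a transformed
    solution, the new right-hand sides appear by polynomial identities
    ([B3_rhs_s0] to [B3_rhs_s3]).  These are free of denominators because the
    parameter is written as a product, such as [be0 = u * (x - eta)], where [u]
    is the correction added to the solution.  A transformed solution exists
    only off the polar hypersurface of the transformation, even where numerator
    and denominator vanish together: the numerator is not identically zero on
    the polar hyperplane, hence every denominator vanishes all along it
    ([value_off_hyperplane]).  Away from the poles the value of the
    transformation is the one computed from the formulas, by uniqueness of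
    values, and the same relation [value_at], with evaluation at a point of the
    differential field for [ev], is the relation [has_value].

    Weyl group relations.  As the generators are involutions, each relation
    amounts to a braid identity, and a morphism of the function field is
    determined by the images of the coordinates.  On these the two sides are
    compared by means of a few polynomials, essentially the numerators of the
    transformed coordinates, on which the generators act almost
    monomially ([braid3_on_coordinates], [braid4_on_coordinates]). *)

(** * Fraction fields *)

Lemma fraction_repr (A : idomainType) (u : {fraction A}) :
  u = tofrac \n_(repr u) / tofrac \d_(repr u).
Proof.
set r := repr u; have r0 : tofrac \d_r != 0 by rewrite tofrac_eq0 denom_ratioP.
apply: (mulIf r0); rewrite mulfVK //.
have tofracE (a : A) : tofrac a = \pi_({fraction A})%qT (Ratio a 1).
  by rewrite /tofrac; unlock FracField.tofrac.
rewrite !tofracE -[u]reprK -/r -[LHS]FracField.pi_mul.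
apply/eqP; rewrite FracField.equivf_def /FracField.mulf /=.
by rewrite !numden_Ratio ?mulf_neq0 ?oner_eq0 ?denom_ratioP // !mulr1 mulrC.
Qed.

Lemma fraction_ind (A : idomainType) (P : {fraction A} -> Prop) :
  (forall p q, q != 0 -> P (tofrac p / tofrac q)) -> forall u, P u.
Proof. by move=> IH u; rewrite [u]fraction_repr; apply/IH/denom_ratioP. Qed.

Section FracLift.
Variables (A : idomainType) (F : fieldType) (phi : {rmorphism A -> F}).
Hypothesis phi_inj : injective phi.

(** The morphism property rests on injectivity of [phi], so the proof is an
    argument; this lets the instances below be found from the term alone. *)
Definition frac_lift of injective phi := fun u : {fraction A} =>
  phi (\n_(repr u)) / phi (\d_(repr u)).

Let phi_neq0 a : a != 0 -> phi a != 0.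
Proof. by apply: contra_neq => pa0; apply: phi_inj; rewrite rmorph0. Qed.

Lemma frac_liftE p q : q != 0 ->
  frac_lift phi_inj (tofrac p / tofrac q) = phi p / phi q.
Proof.
move=> q0; rewrite /frac_lift.
set u := tofrac p / tofrac q; set r := repr u.
have r0 : \d_r != 0 by apply: denom_ratioP.
have /eqP : u * tofrac q * tofrac \d_r = u * tofrac \d_r * tofrac q.
  by rewrite mulrAC.
rewrite {2}[u]fraction_repr /u !mulfVK ?tofrac_eq0 // -!rmorphM tofrac_eq.
by move=> /eqP e; apply/eqP; rewrite eqr_div ?phi_neq0 // -!rmorphM e.
Qed.

Lemma frac_lift_tofrac p : frac_lift phi_inj (tofrac p) = phi p.
Proof.
rewrite -[tofrac p]divr1 -(rmorph1 (@tofrac A)) frac_liftE ?oner_eq0 //.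
by rewrite rmorph1 divr1.
Qed.

Lemma frac_lift_is_zmod_morphism : zmod_morphism (frac_lift phi_inj).
Proof.
elim/fraction_ind=> p q q0; elim/fraction_ind=> p' q' q'0.
have [q0F q'0F] : tofrac q != 0 /\ tofrac q' != 0 by rewrite !tofrac_eq0.
rewrite -mulNr addf_div // -rmorphN -!rmorphM -rmorphD.
rewrite !frac_liftE ?mulf_neq0 // !(rmorphM, rmorphD, rmorphN).
by rewrite -mulNr addf_div ?phi_neq0.
Qed.

Lemma frac_lift_is_monoid_morphism : monoid_morphism (frac_lift phi_inj).
Proof.
split; first by rewrite -(rmorph1 (@tofrac A)) frac_lift_tofrac rmorph1.
elim/fraction_ind=> p q q0; elim/fraction_ind=> p' q' q'0.
by rewrite mulf_div -!rmorphM !frac_liftE ?mulf_neq0 // !rmorphM mulf_div.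
Qed.

HB.instance Definition _ :=
  GRing.isZmodMorphism.Build _ _ (frac_lift phi_inj) frac_lift_is_zmod_morphism.
HB.instance Definition _ :=
  GRing.isMonoidMorphism.Build _ _ (frac_lift phi_inj)
    frac_lift_is_monoid_morphism.

End FracLift.

(** * Values of fractions at a ring morphism *)

Section Values.
Variables (A : idomainType) (F : fieldType) (ev : {rmorphism A -> F}).

(** Two instances matter: for [ev] the evaluation of polynomials at a point of
    a differential field this is [has_value], and for [ev] a substitution of
    fractions for the indeterminates it describes the composition of two
    rational maps. *)
Definition value_at (u : {fraction A}) (w : F) : Prop :=
  exists p q, [/\ u = tofrac p / tofrac q, ev q != 0 & w = ev p / ev q].

Lemma ev_neq0 q : ev q != 0 -> tofrac q != 0.
Proof. by rewrite tofrac_eq0; apply: contra_neq => ->; rewrite rmorph0. Qed.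

Lemma value_tofrac p : value_at (tofrac p) (ev p).
Proof. by exists p, 1; rewrite !rmorph1 !divr1 oner_eq0. Qed.

Lemma value1 : value_at 1 1.
Proof. by have := value_tofrac 1; rewrite !rmorph1. Qed.

Lemma value_nat m : value_at m%:R m%:R.
Proof. by have := value_tofrac m%:R; rewrite !rmorph_nat. Qed.

Lemma valueD u1 u2 w1 w2 :
  value_at u1 w1 -> value_at u2 w2 -> value_at (u1 + u2) (w1 + w2).
Proof.
move=> [p1 [q1 [-> n1 ->]]] [p2 [q2 [-> n2 ->]]].
exists (p1 * q2 + p2 * q1), (q1 * q2).
by rewrite !addf_div ?ev_neq0 // !rmorphD !rmorphM mulf_neq0.
Qed.

Lemma valueM u1 u2 w1 w2 :
  value_at u1 w1 -> value_at u2 w2 -> value_at (u1 * u2) (w1 * w2).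
Proof.
move=> [p1 [q1 [-> n1 ->]]] [p2 [q2 [-> n2 ->]]].
by exists (p1 * p2), (q1 * q2); rewrite !mulf_div !rmorphM mulf_neq0.
Qed.

Lemma valueN u w : value_at u w -> value_at (- u) (- w).
Proof.
by move=> [p [q [-> n ->]]]; exists (- p), q; rewrite !rmorphN !mulNr.
Qed.

Lemma valueB u1 u2 w1 w2 :
  value_at u1 w1 -> value_at u2 w2 -> value_at (u1 - u2) (w1 - w2).
Proof. by move=> v1 v2; apply/valueD/valueN. Qed.

Lemma valueV u w : w != 0 -> value_at u w -> value_at u^-1 w^-1.
Proof.
move=> w0 [p [q [-> n wE]]]; exists q, p; rewrite wE !invf_div; split=> //.
by apply: contra_neq w0 => p0; rewrite wE p0 mul0r.
Qed.

Lemma value_inj u w1 w2 : value_at u w1 -> value_at u w2 -> w1 = w2.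
Proof.
move=> [p1 [q1 [-> n1 ->]]] [p2 [q2 [/eqP e n2 ->]]].
apply/eqP; rewrite eqr_div // -!rmorphM; apply/eqP; congr (ev _).
by apply/eqP; rewrite -tofrac_eq !rmorphM -eqr_div ?ev_neq0.
Qed.

(** Here [sigma] is the specialisation to a hypersurface through the point
    [ev], on which [d] vanishes and [e] does not.  Clearing denominators in
    [p / q = e / d] and specialising gives [sigma q * sigma e = 0], so the
    denominator of every representation of [u] vanishes at [ev]. *)
Lemma no_value_on_pole (sigma : {rmorphism A -> A}) u d e w :
  ev \o sigma =1 ev -> u * tofrac d = tofrac e ->
  sigma d = 0 -> sigma e != 0 -> ~ value_at u w.
Proof.
move=> ev_sigma ude sd se [p [q [uE q0 _]]]; case/eqP: (q0).
suff /eqP : sigma q * sigma e = 0.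
  by rewrite mulf_eq0 (negPf se) orbF -ev_sigma /= => /eqP ->; rewrite rmorph0.
rewrite -rmorphM -[RHS](mulr0 (sigma p)) -sd -rmorphM; congr (sigma _).
apply/eqP; rewrite -tofrac_eq !rmorphM /= -ude uE mulrA.
by rewrite [_ * (_ / _)]mulrC mulfVK ?ev_neq0.
Qed.
End Values.

Section SelfInverse.
Variables (A : idomainType) (phi : {rmorphism A -> {fraction A}}).
Hypothesis phiK : forall p, value_at phi (phi p) (tofrac p).

(** If [phi p = 0] then the value of [phi p] is both [0] and [p]. *)
Lemma self_inverse_inj : injective phi.
Proof.
suff phi_eq0 p : phi p = 0 -> p = 0 by apply: raddf_inj => p /phi_eq0.
move=> p0; apply/eqP; rewrite -tofrac_eq0; apply/eqP.
apply: value_inj (phiK p) _; rewrite p0.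
by have := value_tofrac phi 0; rewrite !rmorph0.
Qed.

Lemma frac_lift_value (F : fieldType) (ev : {rmorphism A -> F})
    (inj : injective ev) u w : value_at ev u w -> frac_lift inj u = w.
Proof.
move=> [p [q [-> q0 ->]]]; apply: frac_liftE.
by rewrite -tofrac_eq0 (ev_neq0 q0).
Qed.

Lemma self_inverse_lift : involutive (frac_lift self_inverse_inj).
Proof.
elim/fraction_ind => p q q0; rewrite frac_liftE // fmorph_div.
by congr (_ / _); apply: frac_lift_value.
Qed.
End SelfInverse.

(** * Rational functions in several indeterminates *)

Section RationalFunctions.
Variables (n : nat) (k : fieldType).
Local Notation A := {mpoly k[n]}.
Local Notation K := {fraction A}.

Lemma mpoly_ring_ind (P : A -> Prop) :
    (forall c, P c%:MP) -> (forall i, P 'X_i) ->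
    (forall p q, P p -> P q -> P (p + q)) ->
    (forall p q, P p -> P q -> P (p * q)) ->
  forall p, P p.
Proof.
move=> PC PX PD PM; elim/mpolyind=> [|c m p _ _ Pp].
  by rewrite -mpolyC0; apply: PC.
apply: PD => //; rewrite -mul_mpolyC; apply: (PM) => //; rewrite mpolyXE_id.
elim/big_ind: _ => [||i _]; [by rewrite -mpolyC1; apply: PC | exact: (PM) |].
elim: (m i) => [|j IHj]; first by rewrite expr0 -mpolyC1; apply: PC.
by rewrite exprS; apply: PM.
Qed.

Lemma mpoly_rmorph_eq (S : pzRingType) (f g : {rmorphism A -> S}) :
  (forall c, f c%:MP = g c%:MP) -> (forall i, f 'X_i = g 'X_i) -> f =1 g.
Proof.
move=> fgC fgX; apply: mpoly_ring_ind => // p q fgp fgq.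
  by rewrite !rmorphD fgp fgq.
by rewrite !rmorphM fgp fgq.
Qed.

Lemma ratfun_rmorph_eq (F : fieldType) (f g : {rmorphism K -> F}) :
  (forall c, f (tofrac c%:MP) = g (tofrac c%:MP)) ->
  (forall i, f (tofrac 'X_i) = g (tofrac 'X_i)) -> f =1 g.
Proof.
move=> fgC fgX; elim/fraction_ind=> p q _; rewrite !fmorph_div.
have fgA : f \o @tofrac A =1 g \o @tofrac A by apply: mpoly_rmorph_eq.
by move: (fgA p) (fgA q) => /= -> ->.
Qed.

(** Polynomials whose image under the substitution has the expected value form
    a subring, so it is enough to look at the indeterminates. *)
Lemma involution_of_images (f : 'I_n -> K) :
  let phi : {rmorphism A -> K} := mmap (@tofrac A \o @mpolyC n k) f in
  (forall i, value_at phi (f i) (tofrac 'X_i)) ->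
  exists s : {rmorphism K -> K},
  [/\ forall c, s (tofrac c%:MP) = tofrac c%:MP,
      forall i, s (tofrac 'X_i) = f i & involutive s].
Proof.
move=> phi fK; have phiC c : phi c%:MP = tofrac c%:MP by rewrite /phi /= mmapC.
have phiX i : phi 'X_i = f i by rewrite /phi /= mmapX mmap1U.
have phiK p : value_at phi (phi p) (tofrac p).
  elim/mpoly_ring_ind: p => [c|i|p q|p q].
  - by rewrite phiC -[X in value_at _ _ X]phiC; apply: value_tofrac.
  - by rewrite phiX; apply: fK.
  - by rewrite !rmorphD; apply: valueD.
  - by rewrite !rmorphM; apply: valueM.
exists (frac_lift (self_inverse_inj phiK)); split;
  last exact: self_inverse_lift.
  by move=> c; apply: etrans (phiC c); apply: frac_lift_tofrac.
by move=> i; apply: etrans (phiX i); apply: frac_lift_tofrac.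
Qed.

(** A fraction whose denominator is divisible by ['X_i - c] has no value at any
    point of the hyperplane ['X_i = c], as soon as its numerator [e] is nonzero
    at one point [w] of this hyperplane, which may have its coordinates in the
    ground field.  Specialising ['X_i] to [c] is compatible with evaluation at
    both points. *)
Lemma value_off_hyperplane (F : fieldType) (iota : {rmorphism k -> F})
    (v : 'I_n -> F) (i : 'I_n) (c : k) (w : 'I_n -> k) (d e : A) u t :
  u * tofrac (('X_i - c%:MP) * d) = tofrac e -> w i = c -> e.@[w] != 0 ->
  value_at (mmap iota v) u t -> v i != iota c.
Proof.
move=> ude wi ew ut; apply/eqP => vi.
pose sigma : {rmorphism A -> A} :=
  mmap (@mpolyC n k) (fun j => if j == i then c%:MP else 'X_j).
have sX j : sigma 'X_j = if j == i then c%:MP else 'X_j.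
  by rewrite /sigma /= mmapX mmap1U.
have sC a : sigma a%:MP = a%:MP by rewrite /sigma /= mmapC.
apply: (no_value_on_pole (sigma := sigma)) ude _ _ ut.
- apply: mpoly_rmorph_eq => [a|j]; last first.
    rewrite [LHS]/= [X in mmap _ _ X]sX; case: eqP => // ->.
    by rewrite /= mmapC mmapX mmap1U vi.
  by rewrite [LHS]/= [X in mmap _ _ X]sC.
- by rewrite rmorphM rmorphB sX eqxx sC subrr mul0r.
apply: contra_neq ew => se0.
have: meval w (sigma e) = 0 by rewrite se0 rmorph0.
suff /(_ e) /= -> : meval w \o sigma =1 meval w by [].
apply: mpoly_rmorph_eq => [a|j]; first by rewrite [LHS]/= [X in meval _ X]sC.
rewrite [LHS]/= [X in meval _ X]sX; case: eqP => // ->.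
by rewrite /= mevalC mevalXU wi.
Qed.
End RationalFunctions.

(** * Braid relations *)

Lemma commuting_involutions T (f g : T -> T) :
  involutive f -> involutive g -> f \o g =1 g \o f -> iter 2 (f \o g) =1 id.
Proof. by move=> fK gK fg u; rewrite /= [f (g u)]fg /= gK fK. Qed.

Lemma braid3_involutions T (f g : T -> T) :
    involutive f -> involutive g -> f \o g \o f =1 g \o f \o g ->
  iter 3 (f \o g) =1 id.
Proof.
by move=> fK gK fgf u; rewrite /= [f (g (f _))]fgf /= gK fK gK.
Qed.

Lemma braid4_involutions T (f g : T -> T) :
    involutive f -> involutive g ->
    f \o g \o f \o g =1 g \o f \o g \o f ->
  iter 4 (f \o g) =1 id.
Proof.
move=> fK gK fgfg u; rewrite /= [f (g (f (g (f _))))]fgfg /=.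
by rewrite fK gK fK gK.
Qed.

Section Braids.
Variables (K : fieldType) (r s : {rmorphism K -> K}).

Let M := (rmorphD, rmorphM, rmorphN, fmorphV, rmorph_nat, rmorph1).

(** Let [w := z * p - a] and [x := z * p + c].  Then [s] fixes [x] and [r]
    fixes [w], while [s w = r x = z * p]; moreover [s z = w / p] and
    [r p = x / z].  Hence [s (r p)] is fixed by [r] and [r (s z)] by [s], which
    is the braid relation on [p] and [z].  On [q] it follows from that on [p],
    since [q - p] is fixed by both morphisms. *)
Lemma braid3_on_coordinates (p q z a c : K) : p != 0 -> z != 0 ->
    s p = p -> s q = q -> s z = z - a / p -> s a = - a -> s c = c + a ->
    r p = p + c / z -> r q = q + c / z -> r z = z -> r a = a + c -> r c = - c ->
  [/\ s (r (s p)) = r (s (r p)), s (r (s q)) = r (s (r q)),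
      s (r (s z)) = r (s (r z)) & s (r (s c)) = r (s (r c))].
Proof.
move=> p0 z0 sp sq sz sa sc rp rq rz ra rc.
pose E := (M, sp, sq, sz, sa, sc, rp, rq, rz, ra, rc).
(* Not local definitions: [field] has to treat [w] and [x] as atoms. *)
have [w wE] : {w | w = z * p - a} by eexists.
have [x xE] : {x | x = z * p + c} by eexists.
have [sw rw] : s w = z * p /\ r w = w.
  by rewrite wE !E; split; field; rewrite ?p0 ?z0.
have [sx rx] : s x = x /\ r x = z * p.
  by rewrite xE !E; split; field; rewrite ?p0 ?z0.
have w0 : w != 0 by rewrite -(fmorph_eq0 s) sw mulf_neq0.
have x0 : x != 0 by rewrite -(fmorph_eq0 r) rx mulf_neq0.
have szw : s z = w / p by rewrite sz wE; field.
have rpx : r p = x / z by rewrite rp xE; field.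
have srp : s (r p) = p * x / w.
  by rewrite rpx fmorph_div sx szw; field; rewrite ?p0 ?w0.
have rsz : r (s z) = z * w / x.
  by rewrite szw fmorph_div rw rpx; field; rewrite ?z0 ?x0.
have rsrp : r (s (r p)) = s (r p).
  by rewrite srp fmorph_div rmorphM rw rx rpx; field; rewrite ?w0 ?z0.
split; last by rewrite !E; ring.
- by rewrite sp rsrp.
- have [sd rd] : s (q - p) = q - p /\ r (q - p) = q - p.
    by rewrite !rmorphB sq sp rq rp; split=> //; field.
  have -> : q = p + (q - p) by ring.
  move: (q - p) sd rd => d sd rd.
  by rewrite !(rmorphD s, rmorphD r) !(sp, sd, rd, rsrp).
- by rewrite rz rsz fmorph_div rmorphM sw sx szw; field; rewrite ?p0 ?x0.
Qed.

(** Let [n := x * y * z - b * (x + y)] and [w := z * n - c * (c + 2 * b)].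
    Then [s] exchanges [n] with [x * y * z] and fixes [w], and [r] exchanges
    [z * n] with [w].  With [u := x * z + c] and [u' := n + (c + 2 * b) * y] one
    has [r x = u / z], while [s u = u' / y] and [r u' = u']; with [v] and [v']
    the same expressions with [x] and [y] exchanged, it follows that
    [r (s (r x)) = u * u' / w] and [r (s (r y)) = v * v' / w] are fixed by [s],
    and that [s (r (s z)) = n * w / (u' * v')] is fixed by [r]. *)
Lemma braid4_on_coordinates (x y z b c : K) : x != 0 -> y != 0 -> z != 0 ->
    s x = x -> s y = y -> s z = z - b * (x + y) / (x * y) ->
    s b = - b -> s c = c + 2 * b ->
    r x = x + c / z -> r y = y + c / z -> r z = z -> r b = b + c -> r c = - c ->
  [/\ s (r (s (r x))) = r (s (r (s x))), s (r (s (r y))) = r (s (r (s y))),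
      s (r (s (r z))) = r (s (r (s z))), s (r (s (r b))) = r (s (r (s b)))
    & s (r (s (r c))) = r (s (r (s c)))].
Proof.
move=> x0 y0 z0 sx sy sz sb sc rx ry rz rb rc.
pose E := (M, sx, sy, sz, sb, sc, rx, ry, rz, rb, rc).
have [n nE] : {n | n = x * y * z - b * (x + y)} by eexists.
have [w wE] : {w | w = z * n - c * (c + 2 * b)} by eexists.
have [sn rn] : s n = x * y * z /\ r n = w / z.
  by rewrite wE nE !E; split; field; rewrite ?x0 ?y0 ?z0.
have [sw rw] : s w = w /\ r w = z * n.
  by rewrite wE nE !E; split; field; rewrite ?x0 ?y0 ?z0.
have n0 : n != 0 by rewrite -(fmorph_eq0 s) sn !mulf_neq0.
have w0 : w != 0 by rewrite -(fmorph_eq0 r) rw mulf_neq0.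
have szn : s z = n / (x * y) by rewrite sz nE; field; rewrite ?x0 ?y0.
(* Applied with [x], [y] for [t], [t'], in either order. *)
have numerators t t' : t != 0 -> t' != 0 -> t * t' = x * y -> t + t' = x + y ->
    s t = t -> s t' = t' -> r t = t + c / z -> r t' = t' + c / z ->
  exists u u', [/\ u != 0, u' != 0, r t = u / z, s u = u' / t'
                 & s u' = u * t' /\ r u' = u'].
  move=> t0 t'0 ttM ttD st st' rt rt'.
  pose u := t * z + c; pose u' := n + (c + 2 * b) * t'.
  have rtu : r t = u / z by rewrite rt /u; field.
  have u0 : u != 0.
    have : r t != 0 by rewrite fmorph_eq0.
    by rewrite rtu mulf_eq0 negb_or => /andP[].
  have su' : s u' = u * t' by rewrite /u /u' !(M, st', sn, sc, sb) -ttM; ring.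
  exists u, u'; split=> //.
  - by rewrite -(fmorph_eq0 s) su' mulf_neq0.
  - by rewrite /u /u' !(M, sb, sc, st, szn) -ttM; field; rewrite ?t0 ?t'0.
  split=> //; rewrite /u' !(M, rn, rt', rc, rb) wE nE -ttM -ttD.
  by field; rewrite z0.
have [u [u' [u0 u'0 rxu su [su' ru']]]] :=
  numerators _ _ x0 y0 erefl erefl sx sy rx ry.
have [v [v' [v0 v'0 ryv sv [sv' rv']]]] :=
  numerators _ _ y0 x0 (mulrC y x) (addrC y x) sy sx ry rx.
have srx : s (r x) = u' * x / n.
  by rewrite rxu !M su szn; field; rewrite ?x0 ?y0 ?n0.
have sry : s (r y) = v' * y / n.
  by rewrite ryv !M sv szn; field; rewrite ?x0 ?y0 ?n0.
have rsz : r (s z) = z * w / (u * v).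
  by rewrite szn !M rn rxu ryv; field; rewrite ?u0 ?z0 ?v0.
have rsrx : r (s (r x)) = u * u' / w.
  by rewrite srx !M ru' rn rxu; field; rewrite ?w0 ?z0.
have rsry : r (s (r y)) = v * v' / w.
  by rewrite sry !M rv' rn ryv; field; rewrite ?w0 ?z0.
have srsz : s (r (s z)) = n * w / (u' * v').
  by rewrite rsz !M sw su sv szn; field; rewrite ?u'0 ?v'0 ?x0 ?y0.
split.
- by rewrite sx rsrx !M su su' sw; field; rewrite w0 y0.
- by rewrite sy rsry !M sv sv' sw; field; rewrite w0 x0.
- by rewrite rz srsz !M rn rw ru' rv'; field; rewrite u'0 v'0 z0.
- by rewrite !E; ring.
- by rewrite !E; ring.
Qed.
End Braids.

Section WeylCoordinates.
Variables (K : fieldType) (s0 s1 s2 s3 : {rmorphism K -> K}).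
Variables (x y z b0 b1 b2 b3 e : K).

Let imgs (f : K -> K) := (f x, f y, f z, (f b0, f b1, f b2, f b3)).

(** The relation between [s0] and [s2] and that between [s1] and [s2] are the
    same up to the choice of the polar factor: [x - e] for [s0], [y - 1] for
    [s1]. *)
Lemma B3_1_relations_on_coordinates :
    x != 0 -> y != 0 -> z != 0 -> x - e != 0 -> y - 1 != 0 ->
    s0 e = e -> s1 e = e -> s2 e = e -> s3 e = e ->
    imgs s0 = (x, y, z - b0 / (x - e), (- b0, b1, b2 + b0, b3)) ->
    imgs s1 = (x, y, z - b1 / (y - 1), (b0, - b1, b2 + b1, b3)) ->
    imgs s2 = (x + b2 / z, y + b2 / z, z,
               (b0 + b2, b1 + b2, - b2, b3 + b2)) ->
    imgs s3 = (x, y, z - b3 * (x + y) / (x * y), (b0, b1, b2 + 2 * b3, - b3)) ->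
  [/\ imgs (s0 \o s2 \o s0) = imgs (s2 \o s0 \o s2),
      imgs (s1 \o s2 \o s1) = imgs (s2 \o s1 \o s2),
      imgs (s2 \o s3 \o s2 \o s3) = imgs (s3 \o s2 \o s3 \o s2)
    & [/\ imgs (s0 \o s1) = imgs (s1 \o s0),
          imgs (s0 \o s3) = imgs (s3 \o s0)
        & imgs (s1 \o s3) = imgs (s3 \o s1)]].
Proof.
move=> x0 y0 z0 xe0 y10 s0e s1e s2e s3e.
move=> [s0x s0y s0z s0b0 s0b1 s0b2 s0b3] [s1x s1y s1z s1b0 s1b1 s1b2 s1b3].
move=> [s2x s2y s2z s2b0 s2b1 s2b2 s2b3] [s3x s3y s3z s3b0 s3b1 s3b2 s3b3].
pose M := (rmorphD, rmorphM, rmorphN, fmorphV, rmorph_nat, rmorph1).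
have s0p : s0 (x - e) = x - e by rewrite rmorphB s0x s0e.
have s2p : s2 (x - e) = x - e + b2 / z by rewrite rmorphB s2x s2e addrAC.
have s1p : s1 (y - 1) = y - 1 by rewrite rmorphB s1y rmorph1.
have s2q : s2 (y - 1) = y - 1 + b2 / z by rewrite rmorphB s2y rmorph1 addrAC.
rewrite /imgs /=; split.
- have [] := braid3_on_coordinates xe0 z0 s0p s0y s0z s0b0 s0b2
                                   s2p s2y s2z s2b0 s2b2.
  rewrite !rmorphB !(s0e, s2e) => /addIr -> -> -> ->.
  congr (_, (_, _, _, _));
    by rewrite !(M, s0b0, s0b1, s0b2, s0b3, s2b0, s2b1, s2b2, s2b3); ring.
- have [] := braid3_on_coordinates y10 z0 s1p s1x s1z s1b1 s1b2
                                   s2q s2x s2z s2b1 s2b2.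
  rewrite !rmorphB !rmorph1 => /addIr -> -> -> ->.
  congr (_, (_, _, _, _));
    by rewrite !(M, s1b0, s1b1, s1b2, s1b3, s2b0, s2b1, s2b2, s2b3); ring.
- have [-> -> -> -> ->] := braid4_on_coordinates x0 y0 z0
    s3x s3y s3z s3b3 s3b2 s2x s2y s2z s2b3 s2b2.
  congr (_, (_, _, _, _));
    by rewrite !(M, s3b0, s3b1, s3b2, s3b3, s2b0, s2b1, s2b2, s2b3); ring.
pose E := (s0x, s0y, s0z, s0b0, s0b1, s0b2, s0b3, s0e, s1x, s1y, s1z, s1b0,
           s1b1, s1b2, s1b3, s1e, (s3x, s3y, s3z, s3b0, s3b1, s3b2, s3b3, s3e)).
by split; rewrite !E !(M, E); congr (_, _, _, (_, _, _, _)); ring.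
Qed.
End WeylCoordinates.

(** * Transformation of solutions *)

Definition B3_P (K : fieldType) (e b0 b1 b2 b3 : K) := D4_P e b0 b3 b2 b1 b3.
Definition B3_Q (K : fieldType) (e b0 b1 b2 b3 : K) := D4_Q e b0 b3 b2 b1 b3.
Definition B3_R (K : fieldType) (e b0 b1 b2 b3 : K) := D4_R e b0 b3 b2 b1 b3.

Section RightHandSides.
Variables (K : fieldType) (e b0 b1 b2 b3 x y z u : K).
Hypothesis sum1 : b0 + b3 + 2 * b2 + b1 + b3 = 1.

(** In the next four lemmas [u] is the quotient of the parameter of the
    generator by a polynomial in the solution, the denominator of the
    transformation.  The product of [u] with this denominator is constant, so
    the derivative of [u] is a multiple of [u]; the terms in [u] on the
    right-hand sides come from it, once multiplied by the denominator. *)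
Lemma B3_rhs_s0 : u * (x - e) = b0 ->
  let at' F := F e (- b0) b1 (b2 + b0) b3 x y (z - u) : K in
  [/\ at' (@B3_P K) = B3_P e b0 b1 b2 b3 x y z,
      at' (@B3_Q K) = B3_Q e b0 b1 b2 b3 x y z
    & (x - e) * at' (@B3_R K) =
      (x - e) * B3_R e b0 b1 b2 b3 x y z + u * B3_P e b0 b1 b2 b3 x y z].
Proof.
move=> b0E at'; have b1E : b1 = 1 - b0 - 2 * b2 - 2 * b3.
  by rewrite -[X in X - _ - _ - _]sum1; ring.
by rewrite /at' b1E -b0E /B3_P /B3_Q /B3_R /D4_P /D4_Q /D4_R; split; ring.
Qed.

Lemma B3_rhs_s1 : u * (y - 1) = b1 ->
  let at' F := F e b0 (- b1) (b2 + b1) b3 x y (z - u) : K in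
  [/\ at' (@B3_P K) = B3_P e b0 b1 b2 b3 x y z,
      at' (@B3_Q K) = B3_Q e b0 b1 b2 b3 x y z
    & (y - 1) * at' (@B3_R K) =
      (y - 1) * B3_R e b0 b1 b2 b3 x y z - u * B3_Q e b0 b1 b2 b3 x y z].
Proof.
move=> b1E at'; have b0E : b0 = 1 - b1 - 2 * b2 - 2 * b3.
  by rewrite -[X in X - _ - _ - _]sum1; ring.
by rewrite /at' b0E -b1E /B3_P /B3_Q /B3_R /D4_P /D4_Q /D4_R; split; ring.
Qed.

Lemma B3_rhs_s2 : u * z = b2 ->
  let at' F := F e (b0 + b2) (b1 + b2) (- b2) (b3 + b2) (x + u) (y + u) z : K in
  [/\ z * at' (@B3_P K) =
      z * B3_P e b0 b1 b2 b3 x y z - u * B3_R e b0 b1 b2 b3 x y z,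
      z * at' (@B3_Q K) =
      z * B3_Q e b0 b1 b2 b3 x y z + u * B3_R e b0 b1 b2 b3 x y z
    & at' (@B3_R K) = B3_R e b0 b1 b2 b3 x y z].
Proof.
move=> b2E at'; have b0E : b0 = 1 - b1 - 2 * b2 - 2 * b3.
  by rewrite -[X in X - _ - _ - _]sum1; ring.
by rewrite /at' b0E -b2E /B3_P /B3_Q /B3_R /D4_P /D4_Q /D4_R; split; ring.
Qed.

Lemma B3_rhs_s3 : u * (x * y) = b3 ->
  let at' F := F e b0 b1 (b2 + 2 * b3) (- b3) x y (z - u * (x + y)) : K in
  [/\ at' (@B3_P K) = B3_P e b0 b1 b2 b3 x y z,
      at' (@B3_Q K) = B3_Q e b0 b1 b2 b3 x y z
    & (x * y) * at' (@B3_R K) =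
      (x * y) * B3_R e b0 b1 b2 b3 x y z
      + u * (y ^+ 2 * B3_P e b0 b1 b2 b3 x y z
             - x ^+ 2 * B3_Q e b0 b1 b2 b3 x y z)].
Proof.
move=> b3E at'; have b0E : b0 = 1 - b1 - 2 * b2 - 2 * b3.
  by rewrite -[X in X - _ - _ - _]sum1; ring.
by rewrite /at' b0E -b3E /B3_P /B3_Q /B3_R /D4_P /D4_Q /D4_R; split; ring.
Qed.
End RightHandSides.

Section Derivation.
Variables (R : realType) (L : diff_ext R).

HB.instance Definition _ :=
  GRing.RMorphism.copy (@de_const R L) (de_emb L \o (@tofrac _ \o polyC)).

Lemma derB (u v : L) : de_der (u - v) = de_der u - de_der v.
Proof. by apply: (addIr (de_der v)); rewrite subrK -de_derD subrK. Qed.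

Lemma der_quotient (u w : L) (c : R[i]) : w != 0 -> u * w = de_const L c ->
  de_der u = - u * de_der w / w.
Proof.
move=> w0 uw; apply: (mulIf w0); rewrite mulfVK // mulNr.
by apply/eqP; rewrite -addr_eq0 -de_derM uw de_der_const.
Qed.

Lemma der_sub_const (u : L) (c : R[i]) :
  de_der (u - de_const L c) = de_der u.
Proof. by rewrite derB de_der_const subr0. Qed.

Variables (eta : R[i]) (b : Ct R) (be0 be1 be2 be3 : R[i]) (x y z : L).
Hypothesis sol : B3_system eta b be0 be1 be2 be3 x y z.
Local Notation c := (de_const L).

Lemma sum_params_const :
  c be0 + c be3 + 2 * c be2 + c be1 + c be3 = 1.
Proof.
case: sol => sum1 _ _ _; rewrite -[RHS](rmorph1 c) -[in RHS]sum1.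
by rewrite !rmorphD rmorphM rmorph_nat.
Qed.

Lemma B3_solution_s0 : x - c eta != 0 ->
  B3_system eta b (- be0) be1 (be2 + be0) be3 x y (z - c be0 / (x - c eta)).
Proof.
move=> p0; case: sol => sum1 ex ey ez.
set u := c be0 / (x - c eta).
have up : u * (x - c eta) = c be0 by rewrite mulfVK.
move: u up => u up.
have /= [eP eQ eR] := B3_rhs_s0 y z sum_params_const up.
split; first by rewrite -[RHS]sum1; ring.
- by rewrite rmorphN rmorphD [RHS]eP.
- by rewrite rmorphN rmorphD [RHS]eQ.
apply: (mulfI p0); rewrite rmorphN rmorphD [RHS]eR -[B3_P _ _ _ _ _ _ _ _]ex.
rewrite -[B3_R _ _ _ _ _ _ _ _]ez derB (der_quotient p0 up) der_sub_const.
(* The factor common to the three equations is made an atom, so that [field]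
   does not ask for its denominator to be nonzero. *)
by move: (2 * c eta / _) => k; field.
Qed.

Lemma B3_solution_s1 : y - 1 != 0 ->
  B3_system eta b be0 (- be1) (be2 + be1) be3 x y (z - c be1 / (y - 1)).
Proof.
move=> p0; case: sol => sum1 ex ey ez.
set u := c be1 / (y - 1).
have up : u * (y - 1) = c be1 by rewrite mulfVK.
move: u up => u up.
have /= [eP eQ eR] := B3_rhs_s1 (c eta) x z sum_params_const up.
split; first by rewrite -[RHS]sum1; ring.
- by rewrite rmorphN rmorphD [RHS]eP.
- by rewrite rmorphN rmorphD [RHS]eQ.
apply: (mulfI p0); rewrite rmorphN rmorphD [RHS]eR -[B3_Q _ _ _ _ _ _ _ _]ey.
rewrite -[B3_R _ _ _ _ _ _ _ _]ez derB (der_quotient p0 up).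
rewrite -[in de_der (y - 1)](rmorph1 c) der_sub_const.
by move: (2 * c eta / _) => k; field.
Qed.

Lemma B3_solution_s2 : z != 0 ->
  B3_system eta b (be0 + be2) (be1 + be2) (- be2) (be3 + be2)
    (x + c be2 / z) (y + c be2 / z) z.
Proof.
move=> p0; case: sol => sum1 ex ey ez.
set u := c be2 / z.
have up : u * z = c be2 by rewrite mulfVK.
move: u up => u up.
have /= [eP eQ eR] := B3_rhs_s2 (c eta) x y sum_params_const up.
split; first by rewrite -[RHS]sum1; ring.
- apply: (mulfI p0); rewrite rmorphN !rmorphD [RHS]eP -[B3_P _ _ _ _ _ _ _ _]ex.
  rewrite -[B3_R _ _ _ _ _ _ _ _]ez de_derD (der_quotient p0 up).
  by move: (2 * c eta / _) => k; field.
- apply: (mulfI p0); rewrite rmorphN !rmorphD [RHS]eQ -[B3_Q _ _ _ _ _ _ _ _]ey.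
  rewrite -[B3_R _ _ _ _ _ _ _ _]ez de_derD (der_quotient p0 up).
  by move: (2 * c eta / _) => k; field.
- by rewrite rmorphN !rmorphD [RHS]eR.
Qed.

Lemma B3_solution_s3 : x != 0 -> y != 0 ->
  B3_system eta b be0 be1 (be2 + 2 * be3) (- be3)
    x y (z - c be3 * (x + y) / (x * y)).
Proof.
move=> x0 y0; case: sol => sum1 ex ey ez.
have p0 : x * y != 0 by rewrite mulf_neq0.
rewrite mulrAC; set u := c be3 / (x * y).
have up : u * (x * y) = c be3 by rewrite mulfVK.
move: u up => u up.
have /= [eP eQ eR] := B3_rhs_s3 (c eta) z sum_params_const up.
split; first by rewrite -[RHS]sum1; ring.
- by rewrite rmorphN rmorphD rmorphM rmorph_nat [RHS]eP.
- by rewrite rmorphN rmorphD rmorphM rmorph_nat [RHS]eQ.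
apply: (mulfI p0); rewrite rmorphN rmorphD rmorphM rmorph_nat [RHS]eR.
rewrite -[B3_P _ _ _ _ _ _ _ _]ex -[B3_Q _ _ _ _ _ _ _ _]ey.
rewrite -[B3_R _ _ _ _ _ _ _ _]ez derB de_derM de_derD (der_quotient p0 up).
by rewrite de_derM; move: (2 * c eta / _) => k; field; rewrite ?x0 ?y0.
Qed.
End Derivation.

(** * The generators as birational transformations *)

Section Generators.
Variable R : realType.
Local Notation A6 := {mpoly (Ct R)[6]}.
Local Notation K6 := (ratfun R).
Local Notation x := (var_x R).
Local Notation y := (var_y R).
Local Notation z := (var_z R).
Local Notation be0 := (par_be0 R).
Local Notation be1 := (par_be1 R).
Local Notation be2 := (par_be2 R).
Local Notation be3 := (par_be3 R).

HB.instance Definition _ :=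
  GRing.RMorphism.copy (@ratconst R) (@tofrac _ \o @mpolyC 6 (Ct R)).

Lemma coord_ind (P : 'I_6 -> Prop) :
  P (@Ordinal 6 0 isT) -> P (@Ordinal 6 1 isT) -> P (@Ordinal 6 2 isT) ->
  P (@Ordinal 6 3 isT) -> P (@Ordinal 6 4 isT) -> P (@Ordinal 6 5 isT) ->
  forall i, P i.
Proof.
move=> P0 P1 P2 P3 P4 P5 [[|[|[|[|[|[|//]]]]]] lti].
all: by rewrite (bool_irrelevance lti isT).
Qed.

Lemma ratfun_sub_const_neq0 i (c : Ct R) : Defs.coord R i - ratconst c != 0.
Proof.
rewrite -[_ - _](rmorphB (@tofrac A6)) tofrac_eq0; apply/eqP => X0.
have : ('X_i - c%:MP : A6).@[fun=> c + 1] = 0 by rewrite X0 rmorph0.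
by rewrite mevalB mevalXU mevalC addrC addKr; apply/eqP; apply: oner_neq0.
Qed.

Lemma sum_params : be0 + be3 + 2 * be2 + be1 + be3 = 1.
Proof. by rewrite /par_be0; ring. Qed.

Lemma coord_neq0 i : Defs.coord R i != 0.
Proof.
by have := ratfun_sub_const_neq0 i 0; rewrite [ratconst 0]rmorph0 subr0.
Qed.

Lemma var_y_sub1_neq0 : y - 1 != 0.
Proof.
have := ratfun_sub_const_neq0 (@Ordinal 6 1 isT) 1.
by rewrite [ratconst 1]rmorph1.
Qed.

Lemma ratfun_rmorph_eq_images (f g : {rmorphism K6 -> K6}) :
  (forall c, f (ratconst c) = ratconst c) ->
  (forall c, g (ratconst c) = ratconst c) -> images f = images g -> f =1 g.
Proof.
move=> fC gC [ex ey ez _ e1 e2 e3]; apply: ratfun_rmorph_eq => [c|].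
  by rewrite [LHS]fC [RHS]gC.
by apply: coord_ind;
  [apply: ex | apply: ey | apply: ez | apply: e1 | apply: e2 | apply: e3].
Qed.

Lemma value_be0 (F : fieldType) (ev : {rmorphism A6 -> F}) w1 w2 w3 :
  value_at ev be1 w1 -> value_at ev be2 w2 -> value_at ev be3 w3 ->
  value_at ev be0 (1 - w1 - 2 * w2 - 2 * w3).
Proof.
move=> v1 v2 v3; apply: valueB (valueM (value_nat _ 2) v3).
by apply: valueB (valueM (value_nat _ 2) v2); apply: valueB (value1 _) v1.
Qed.

(** [phi] is the substitution of the proposed images for the coordinates.  The
    conditions on it say that these images, computed at themselves, give back
    the coordinates. *)
Lemma involution_of_coords (fx fy fz f0 f1 f2 f3 : K6) :
  f0 = 1 - f1 - 2 * f2 - 2 * f3 ->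
  (forall phi : {rmorphism A6 -> K6},
    let val := value_at phi in
    (forall c, val (ratconst c) (ratconst c)) ->
    [/\ val x fx, val y fy & val z fz] ->
    [/\ val be0 f0, val be1 f1, val be2 f2 & val be3 f3] ->
    [/\ val fx x, val fy y & val fz z] /\
    [/\ val f1 be1, val f2 be2 & val f3 be3]) ->
  exists s : {rmorphism K6 -> K6},
  [/\ forall c, s (ratconst c) = ratconst c, involutive s
    & images s = (fx, fy, fz, (f0, f1, f2, f3))].
Proof.
move=> f0E fK.
pose f (i : 'I_6) : K6 := nth 0 [:: fx; fy; fz; f1; f2; f3] i.
have [|s [sC sX sK]] := @involution_of_images 6 (Ct R) f; last first.
  exists s; split=> //.
  have s1 : s be1 = f1 := sX _.
  have s2 : s be2 = f2 := sX _.
  have s3 : s be3 = f3 := sX _.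
  rewrite /images s1 s2 s3 [s x]sX [s y]sX [s z]sX /f /= f0E.
  by rewrite {1}/par_be0 !rmorphB !rmorphM !rmorph_nat rmorph1 s1 s2 s3.
set phi : {rmorphism A6 -> K6} := (X in value_at X).
have phiC c : value_at phi (ratconst c) (ratconst c).
  have := value_tofrac phi c%:MP.
  by rewrite [X in value_at _ _ X]/= mmapC.
have phiX i : value_at phi (Defs.coord R i) (f i).
  have := value_tofrac phi 'X_i.
  by rewrite [X in value_at _ _ X]/= mmapX mmap1U.
have v1 : value_at phi be1 f1 := phiX _.
have v2 : value_at phi be2 f2 := phiX _.
have v3 : value_at phi be3 f3 := phiX _.
have v0 : value_at phi be0 f0 by rewrite f0E; apply: value_be0.
have [[wx wy wz] [w1 w2 w3]] := fK phi phiC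
  (And3 (phiX _) (phiX _) (phiX _)) (And4 v0 v1 v2 v3).
by apply: coord_ind.
Qed.

Lemma exists_s0 (eta : Ct R) : exists s : {rmorphism K6 -> K6},
  [/\ forall c, s (ratconst c) = ratconst c, involutive s
    & images s = (x, y, z - be0 / (x - ratconst eta),
                  (- be0, be1, be2 + be0, be3))].
Proof.
have p0 := ratfun_sub_const_neq0 (@Ordinal 6 0 isT) eta.
apply: involution_of_coords.
  by rewrite -[X in X - _ - _ - _]sum_params; ring.
move=> phi val vC [vx vy vz] [v0 v1 v2 v3]; split; split=> //.
  have := valueB vz (valueM v0 (valueV p0 (valueB vx (vC eta)))).
  by rewrite mulNr opprK subrK.
by have := valueD v2 v0; rewrite addrK.
Qed.

Lemma exists_s1 : exists s : {rmorphism K6 -> K6},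
  [/\ forall c, s (ratconst c) = ratconst c, involutive s
    & images s = (x, y, z - be1 / (y - 1), (be0, - be1, be2 + be1, be3))].
Proof.
have p0 := var_y_sub1_neq0.
apply: involution_of_coords.
  by rewrite -[X in X - _ - _ - _]sum_params; ring.
move=> phi val vC [vx vy vz] [v0 v1 v2 v3]; split; split=> //.
- have := valueB vz (valueM v1 (valueV p0 (valueB vy (value1 _)))).
  by rewrite mulNr opprK subrK.
- by have := valueN v1; rewrite opprK.
- by have := valueD v2 v1; rewrite addrK.
Qed.

Lemma exists_s2 : exists s : {rmorphism K6 -> K6},
  [/\ forall c, s (ratconst c) = ratconst c, involutive s
    & images s = (x + be2 / z, y + be2 / z, z,
                  (be0 + be2, be1 + be2, - be2, be3 + be2))].
Proof.
apply: involution_of_coords.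
  by rewrite -[X in X - _ - _ - _]sum_params; ring.
move=> phi val vC [vx vy vz] [v0 v1 v2 v3].
have vq : val (be2 / z) (- be2 / z).
  by apply: valueM v2 _; apply: valueV (coord_neq0 _) vz.
split; split=> //.
- by have := valueD vx vq; rewrite mulNr addrK.
- by have := valueD vy vq; rewrite mulNr addrK.
- by have := valueD v1 v2; rewrite addrK.
- by have := valueN v2; rewrite opprK.
- by have := valueD v3 v2; rewrite addrK.
Qed.

Lemma exists_s3 : exists s : {rmorphism K6 -> K6},
  [/\ forall c, s (ratconst c) = ratconst c, involutive s
    & images s = (x, y, z - be3 * (x + y) / (x * y),
                  (be0, be1, be2 + 2 * be3, - be3))].
Proof.
apply: involution_of_coords.
  by rewrite -[X in X - _ - _ - _]sum_params; ring.
move=> phi val vC [vx vy vz] [v0 v1 v2 v3].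
split; split=> //.
- have xy0 : x * y != 0 by rewrite mulf_neq0 ?coord_neq0.
  have vq := valueM (valueM v3 (valueD vx vy)) (valueV xy0 (valueM vx vy)).
  by have := valueB vz vq; rewrite !mulNr opprK subrK.
- have := valueD v2 (valueD v3 v3).
  have -> : be2 + 2 * be3 + (- be3 + - be3) = be2 by ring.
  by have -> : be2 + (be3 + be3) = be2 + 2 * be3 by ring.
- by have := valueN v3; rewrite opprK.
Qed.

(** * The generators on solutions *)

(** By uniqueness of values, it suffices to exhibit one value of each coordinate
    that is a solution.  The hypotheses that [s x] and [s z] have values are
    kept, because they are what excludes the poles. *)
Lemma takes_B3_intro (eta : R[i]) (b : Ct R) (s : K6 -> K6) :
  (forall (L : diff_ext R) b0 b1 b2 b3 (x0 y0 z0 : L),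
    B3_system eta b b0 b1 b2 b3 x0 y0 z0 ->
    let c := de_const L in
    let val := value_at (mmap (de_emb L) (point x0 y0 z0 b1 b2 b3)) in
    (forall a, val (ratconst a) (de_emb L a)) ->
    [/\ val x x0, val y y0 & val z z0] ->
    [/\ val be0 (c b0), val be1 (c b1), val be2 (c b2) & val be3 (c b3)] ->
    (exists t, val (s x) t) -> (exists t, val (s z) t) ->
    exists b0' b1' b2' b3' x' y' z',
    [/\ [/\ val (s x) x', val (s y) y' & val (s z) z'],
        [/\ val (s be0) (c b0'), val (s be1) (c b1'), val (s be2) (c b2')
          & val (s be3) (c b3')]
      & B3_system eta b b0' b1' b2' b3' x' y' z']) ->
  takes_B3_system eta b s.
Proof.
move=> IH L b0 b1 b2 b3 x0 y0 z0 sol x' y' z' w0 w1 w2 w3 v.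
move=> hx hy hz h0 h1 h2 h3.
have vC a : value_at (mmap (de_emb L) v) (ratconst a) (de_emb L a).
  have := value_tofrac (mmap (de_emb L) v) a%:MP.
  by rewrite [X in value_at _ _ X]mmapC.
have vX i : value_at (mmap (de_emb L) v) (Defs.coord R i) (v i).
  have := value_tofrac (mmap (de_emb L) v) 'X_i.
  by rewrite [X in value_at _ _ X]mmapX mmap1U.
have v1 : value_at (mmap (de_emb L) v) be1 (de_const L b1) := vX _.
have v2 : value_at (mmap (de_emb L) v) be2 (de_const L b2) := vX _.
have v3 : value_at (mmap (de_emb L) v) be3 (de_const L b3) := vX _.
have v0 : value_at (mmap (de_emb L) v) be0 (de_const L b0).
  have := value_be0 v1 v2 v3.
  by rewrite -[X in X - _ - _ - _](sum_params_const sol); congr value_at; ring.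
have [b0' [b1' [b2' [b3' [x1 [y1 [z1]]]]]]] :=
  IH L _ _ _ _ _ _ _ sol vC (And3 (vX _) (vX _) (vX _)) (And4 v0 v1 v2 v3)
     (ex_intro _ _ hx) (ex_intro _ _ hz).
move=> [[ex ey ez] [e0 e1 e2 e3] sol']; exists b0', b1', b2', b3'.
rewrite (value_inj hx ex) (value_inj hy ey) (value_inj hz ez).
rewrite (value_inj h0 e0) (value_inj h1 e1).
by rewrite (value_inj h2 e2) (value_inj h3 e3).
Qed.

Local Notation pX i := ('X_(@Ordinal 6 i isT) : A6).

(** In the next four lemmas [e] is the numerator of the transformed coordinate,
    and [w] a point of the polar hyperplane where [e] does not vanish. *)
Lemma s0_regular (L : diff_ext R) (v : 'I_6 -> L) (eta : Ct R) t :
  value_at (mmap (de_emb L) v) (z - be0 / (x - ratconst eta)) t ->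
  v (@Ordinal 6 0 isT) - de_emb L eta != 0.
Proof.
have p0 := ratfun_sub_const_neq0 (@Ordinal 6 0 isT) eta.
pose w (i : 'I_6) : Ct R := if val i == 0 then eta else 0.
pose e : A6 := pX 2 * (pX 0 - eta%:MP) - (1 - pX 3 - 2 * pX 4 - 2 * pX 5).
rewrite subr_eq0; apply: (@value_off_hyperplane _ _ _ _ _ _ eta w 1 e) => //.
  have -> : tofrac e = z * (x - ratconst eta) - be0.
    by rewrite !(rmorphB, rmorphM, rmorph_nat, rmorph1).
  by rewrite mulr1 rmorphB [LHS]mulrBl mulfVK.
have -> : e.@[w] = -1.
  by rewrite /e !(rmorphB, rmorphM, rmorph_nat, rmorph1) /= !mevalXU /=; ring.
by rewrite oppr_eq0 oner_neq0.
Qed.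

Lemma s1_regular (L : diff_ext R) (v : 'I_6 -> L) t :
  value_at (mmap (de_emb L) v) (z - be1 / (y - 1)) t ->
  v (@Ordinal 6 1 isT) - 1 != 0.
Proof.
have p0 := var_y_sub1_neq0.
pose w (i : 'I_6) : Ct R := if val i \in [:: 1; 3]%N then 1 else 0.
pose e : A6 := pX 2 * (pX 1 - 1) - pX 3.
rewrite subr_eq0 -[1 in X in _ -> X](rmorph1 (de_emb L)).
apply: (@value_off_hyperplane _ _ _ _ _ _ 1 w 1 e) => //.
  have -> : tofrac e = z * (y - 1) - be1.
    by rewrite !(rmorphB, rmorphM, rmorph1).
  by rewrite mulr1 rmorphB !rmorph1 [LHS]mulrBl mulfVK.
have -> : e.@[w] = -1.
  by rewrite /e !(rmorphB, rmorphM, rmorph1) /= !mevalXU /=; ring.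
by rewrite oppr_eq0 oner_neq0.
Qed.

Lemma s2_regular (L : diff_ext R) (v : 'I_6 -> L) t :
  value_at (mmap (de_emb L) v) (x + be2 / z) t ->
  v (@Ordinal 6 2 isT) != 0.
Proof.
pose w (i : 'I_6) : Ct R := if val i == 4 then 1 else 0.
pose e : A6 := pX 0 * pX 2 + pX 4.
rewrite -[0 in X in _ -> X](rmorph0 (de_emb L)).
apply: (@value_off_hyperplane _ _ _ _ _ _ 0 w 1 e) => //.
  have -> : tofrac e = x * z + be2 by rewrite rmorphD rmorphM.
  by rewrite mulr1 rmorph0 subr0 [LHS]mulrDl mulfVK ?coord_neq0.
have -> : e.@[w] = 1.
  by rewrite /e !(rmorphD, rmorphM) /= !mevalXU /=; ring.
by rewrite oner_neq0.
Qed.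

Lemma s3_regular (L : diff_ext R) (v : 'I_6 -> L) t :
  value_at (mmap (de_emb L) v) (z - be3 * (x + y) / (x * y)) t ->
  v (@Ordinal 6 0 isT) != 0 /\ v (@Ordinal 6 1 isT) != 0.
Proof.
have xy0 : x * y != 0 by rewrite mulf_neq0 ?coord_neq0.
pose e : A6 := pX 2 * (pX 0 * pX 1) - pX 5 * (pX 0 + pX 1).
have eE : (z - be3 * (x + y) / (x * y)) * (x * y) = tofrac e.
  by rewrite [RHS]rmorphB !rmorphM rmorphD mulrBl [in LHS]mulfVK.
rewrite -(rmorph0 (de_emb L)) => u_t; split.
  pose w (i : 'I_6) : Ct R := if val i \in [:: 1; 5]%N then 1 else 0.
  apply: (@value_off_hyperplane _ _ _ _ _ _ 0 w (pX 1) e) u_t => //.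
    by rewrite -eE rmorph0 subr0 rmorphM.
  have -> : e.@[w] = -1.
    by rewrite /e !(rmorphB, rmorphD, rmorphM) /= !mevalXU /=; ring.
  by rewrite oppr_eq0 oner_neq0.
pose w (i : 'I_6) : Ct R := if val i \in [:: 0; 5]%N then 1 else 0.
apply: (@value_off_hyperplane _ _ _ _ _ _ 0 w (pX 0) e) u_t => //.
  by rewrite -eE rmorph0 subr0 rmorphM [y * x]mulrC.
have -> : e.@[w] = -1.
  by rewrite /e !(rmorphB, rmorphD, rmorphM) /= !mevalXU /=; ring.
by rewrite oppr_eq0 oner_neq0.
Qed.

Lemma takes_s0 (eta : R[i]) (b : Ct R) (s : K6 -> K6) :
  images s = (x, y, z - be0 / (x - ratconst (constCt eta)),
              (- be0, be1, be2 + be0, be3)) -> takes_B3_system eta b s.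
Proof.
move=> [sx sy sz s0 s1 s2 s3]; apply: takes_B3_intro.
rewrite sx sy sz s0 s1 s2 s3.
move=> L b0 b1 b2 b3 x0 y0 z0 sol c val vC [vx vy vz] [v0 v1 v2 v3].
move=> _ [t /s0_regular p0].
exists (- b0), b1, (b2 + b0), b3, x0, y0, (z0 - c b0 / (x0 - c eta)).
split; [split=> // | split=> // | exact: B3_solution_s0].
- exact: valueB vz (valueM v0 (valueV p0 (valueB vx (vC _)))).
- by rewrite /c rmorphN; apply: valueN.
- by rewrite /c rmorphD; apply: valueD.
Qed.

Lemma takes_s1 (eta : R[i]) (b : Ct R) (s : K6 -> K6) :
  images s = (x, y, z - be1 / (y - 1), (be0, - be1, be2 + be1, be3)) ->
  takes_B3_system eta b s.
Proof.
move=> [sx sy sz s0 s1 s2 s3]; apply: takes_B3_intro.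
rewrite sx sy sz s0 s1 s2 s3.
move=> L b0 b1 b2 b3 x0 y0 z0 sol c val vC [vx vy vz] [v0 v1 v2 v3].
move=> _ [t /s1_regular p0].
exists b0, (- b1), (b2 + b1), b3, x0, y0, (z0 - c b1 / (y0 - 1)).
split; [split=> // | split=> // | exact: B3_solution_s1].
- exact: valueB vz (valueM v1 (valueV p0 (valueB vy (value1 _)))).
- by rewrite /c rmorphN; apply: valueN.
- by rewrite /c rmorphD; apply: valueD.
Qed.

Lemma takes_s2 (eta : R[i]) (b : Ct R) (s : K6 -> K6) :
  images s = (x + be2 / z, y + be2 / z, z,
              (be0 + be2, be1 + be2, - be2, be3 + be2)) ->
  takes_B3_system eta b s.
Proof.
move=> [sx sy sz s0 s1 s2 s3]; apply: takes_B3_intro.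
rewrite sx sy sz s0 s1 s2 s3.
move=> L b0 b1 b2 b3 x0 y0 z0 sol c val vC [vx vy vz] [v0 v1 v2 v3].
move=> [t /s2_regular p0] _.
exists (b0 + b2), (b1 + b2), (- b2), (b3 + b2).
exists (x0 + c b2 / z0), (y0 + c b2 / z0), z0.
have vq := valueM v2 (valueV p0 vz).
split; [by split=> //; apply: valueD | | exact: B3_solution_s2].
by rewrite /c rmorphN !rmorphD; split; by [apply: valueN | apply: valueD].
Qed.

Lemma takes_s3 (eta : R[i]) (b : Ct R) (s : K6 -> K6) :
  images s = (x, y, z - be3 * (x + y) / (x * y),
              (be0, be1, be2 + 2 * be3, - be3)) ->
  takes_B3_system eta b s.
Proof.
move=> [sx sy sz s0 s1 s2 s3]; apply: takes_B3_intro.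
rewrite sx sy sz s0 s1 s2 s3.
move=> L b0 b1 b2 b3 x0 y0 z0 sol c val vC [vx vy vz] [v0 v1 v2 v3].
move=> _ [t /s3_regular [p0 q0]].
exists b0, b1, (b2 + 2 * b3), (- b3).
exists x0, y0, (z0 - c b3 * (x0 + y0) / (x0 * y0)).
split; [split=> // | split=> // | exact: B3_solution_s3].
- have vq := valueV (mulf_neq0 p0 q0) (valueM vx vy).
  exact: valueB vz (valueM (valueM v3 (valueD vx vy)) vq).
- rewrite /c rmorphD rmorphM rmorph_nat; apply: (valueD v2).
  by rewrite !mulr_natl !mulr2n; apply: valueD.
- by rewrite /c rmorphN; apply: valueN.
Qed.
End Generators.

Theorem theorem4p2 (R : realType) (eta : R[i]) (b : Ct R)
    (eta_neq0 : eta != 0) (b_neq0 : b != 0) :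
  let x := var_x R in let y := var_y R in let z := var_z R in
  let be0 := par_be0 R in let be1 := par_be1 R in
  let be2 := par_be2 R in let be3 := par_be3 R in
  let et := ratconst (constCt eta) in
  exists s0 s1 s2 s3 : {rmorphism ratfun R -> ratfun R},
    [/\ [/\ images s0 = (x, y, z - be0 / (x - et),
                         (- be0, be1, be2 + be0, be3)),
            images s1 = (x, y, z - be1 / (y - 1),
                         (be0, - be1, be2 + be1, be3)),
            images s2 = (x + be2 / z, y + be2 / z, z,
                         (be0 + be2, be1 + be2, - be2, be3 + be2))
          & images s3 = (x, y, z - be3 * (x + y) / (x * y),
                         (be0, be1, be2 + 2 * be3, - be3))],
        [/\ backlund_B3 eta b s0, backlund_B3 eta b s1,
            backlund_B3 eta b s2 & backlund_B3 eta b s3]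
      & weyl_B3_1 s0 s1 s2 s3].
Proof.
move=> x y z be0 be1 be2 be3 et.
have [s0 [C0 K0 i0]] := exists_s0 (constCt eta).
have [s1 [C1 K1 i1]] := exists_s1 R.
have [s2 [C2 K2 i2]] := exists_s2 R.
have [s3 [C3 K3 i3]] := exists_s3 R.
exists s0, s1, s2, s3; split=> //.
  split; (split; [by split=> //; apply: inv_bij|]).
  - exact: takes_s0.
  - exact: takes_s1.
  - exact: takes_s2.
  - exact: takes_s3.
have [x0 y0 z0] : [/\ x != 0, y != 0 & z != 0] by split; apply: coord_neq0.
have xe0 : x - et != 0 by apply: ratfun_sub_const_neq0.
have y10 : y - 1 != 0 := var_y_sub1_neq0 R.
have [r02 r12 r23 [r01 r03 r13]] := B3_1_relations_on_coordinates
  x0 y0 z0 xe0 y10 (C0 _) (C1 _) (C2 _) (C3 _) i0 i1 i2 i3.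
split=> //.
- by split; apply: braid3_involutions => //;
    apply: ratfun_rmorph_eq_images => // c; rewrite /= !(C0, C1, C2).
- apply: braid4_involutions => //.
  by apply: ratfun_rmorph_eq_images => // c; rewrite /= !(C3, C2).
by split; apply: commuting_involutions => //;
  apply: ratfun_rmorph_eq_images => // c; rewrite /= !(C0, C1, C3).
Qed.
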